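(* There is an absolute constant $c>0$ such that for every $k\in\mathbb{N}$ with $k\ne 1$, $$h(k)\ge c\,\frac{k}{\log k}.$$
   Context: $\mathbb{N}=\{1,2,3,\dots\}$ and $[n]=\{1,2,\dots,n\}$. For finite $A,B\subseteq\mathbb{N}$, $A\ast B$ is the set of $x\in\mathbb{N}$ for which the number of pairs $(a,b)\in A\times B$ with $ab=x$ is odd. For a finite set $A=\{a_1<\cdots<a_k\}\subseteq\mathbb{N}$, $$h(A)=\sum_{r=1}^{k}\ \sum_{1\le i_1<\cdots<i_r\le k}(-2)^{r-1}\frac{a_{i_1}}{[a_{i_1},\dots,a_{i_r}]},$$ where $[\cdot,\dots,\cdot]$ denotes the least common multiple; equivalently, $h(A)=\lim_{n\to\infty}|A\ast[n]|/n$ (the limit exists). For $k\in\mathbb{N}$, $h(k)=\inf\{h(A): A\subseteq\mathbb{N},\ |A|=k\}$. *)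

(* Defs.v *)
From HB Require Import structures.
From mathcomp Require Import all_boot all_order all_algebra.
From mathcomp Require Import finmap.
From mathcomp Require Import all_classical all_reals all_analysis.

Set Implicit Arguments.
Unset Strict Implicit.
Unset Printing Implicit Defensive.

Import Order.TTheory GRing.Theory Num.Theory.

Local Open Scope fset_scope.
Local Open Scope classical_set_scope.
Local Open Scope ring_scope.

Definition positive_fset (A : {fset nat}) : Prop :=
  forall a : nat, a \in A -> (0 < a)%N.

(* The default of [head] is used only for the empty set, which does not occur
   in hset below, where #|` S| >= 1. *)
Definition fset_min (S : {fset nat}) : nat := head 0%N (sort leq S).

Definition fset_lcm (S : {fset nat}) : nat :=
  (\big[lcmn/1]_(a <- S) a)%N.

(* A choice of indices i_1 < ... < i_r in [k] is the same thing as a subset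
   S = {a_(i_1) < ... < a_(i_r)} of A of cardinality r, and then a_(i_1) is
   the minimum of S. *)
Definition hset {R : realType} (A : {fset nat}) : R :=
  \sum_(1 <= r < (#|` A|).+1)
    \sum_(S <- fpowerset A | #|` S| == r)
      (- 2%:R) ^+ r.-1 * ((fset_min S)%:R / (fset_lcm S)%:R).

(* The library's [inf] is a genuine infimum only on nonempty sets that are
   bounded below, and is 0 otherwise. Here the set is nonempty for every k,
   and bounded below by 0: hset A is the limit of N_n / n, where N_n counts the
   x with an odd number of factorizations x = a * b, a \in A, 1 <= b <= n. *)
Definition hcard {R : realType} (k : nat) : R :=
  inf [set hset A | A in [set A : {fset nat} |
                           positive_fset A /\ #|` A| = k]].

(* Main.v *)
Require Import Defs.
From HB Require Import structures.
From mathcomp Require Import all_boot all_order all_algebra.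
From mathcomp Require Import finmap.
From mathcomp Require Import all_classical all_reals all_analysis.
From mathcomp Require Import zify ring lra.

(** For a nonnegative integer x let D_x be the set of elements of A dividing x.
    Replacing each 1 / lcm S by the density of the common multiples of S turns
    h(A) into the average over x of the alternating sum
    d_m - d_(m-1) + d_(m-2) - ... of D_x = {d_1 < ... < d_m}
    ([hset_average]; the average runs over one period). This alternating sum is
    nonnegative, and it is at least a / 2 when a belongs to D_x and every element
    of D_x divides a, since the other elements are then at most a / 2
    ([altsum_ge_half]). Call a the top divisor of x in that case; it is unique, so
    the contributions of the different elements of A add up.

    It remains to see that each a is often a top divisor. Write x = a w, so that x
    is a multiple of a with probability 1 / a. The integer a is the top divisor of
    a w unless some b in A not dividing a divides a w, that is, unless
    q = b / gcd a b > 1 divides w. Let y = 2k, where k = |A|, and restrict to the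
    w without prime factor up to y: such a w is divisible only by those q all of
    whose prime factors exceed y, each with conditional probability 1 / q < 1 / y,
    so by the union bound at least half of these w are good
    ([count_top_divisor]). Hence every a contributes at least
    (a / 2) (1 / a) (1 / 2) times the product of the 1 - 1/p over the primes
    p <= 2k, and h(A) is at least k / 4 times this product ([hset_ge]).

    By Mertens the product is at least c / ln (2k) ([prod_prime_ge]). Only upper
    bounds on sums over primes enter: Chebyshev's primorial bound and the
    factorization of n! bound the sum of ln p / p by ln n + O(1), and Abel
    summation bounds the sum of 1 / p by ln ln n + O(1). *)

Set Implicit Arguments.
Unset Strict Implicit.
Unset Printing Implicit Defensive.

Import Order.TTheory GRing.Theory Num.Theory.

(** * Products of primes *)

(** Distinct primes have coprime powers, so divisibility by each power gives
    divisibility by the product. It serves both the primorial bound (primes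
    dividing a binomial coefficient) and the bound on n! below. *)
Lemma prod_prime_powers_dvd (N : nat) (e : nat -> nat) (s : seq nat) :
  uniq s -> {in s, forall p, prime p && (p ^ e p %| N)} ->
  \prod_(p <- s) p ^ e p %| N.
Proof.
elim: s => [|p s IHs] /=; first by rewrite big_nil dvd1n.
move=> /andP[pNs us] sP.
have /andP[pp pN] := sP p (mem_head _ _).
have sP' : {in s, forall q, prime q && (q ^ e q %| N)}.
  by move=> q qs; apply: sP; rewrite inE qs orbT.
rewrite big_cons Gauss_dvd ?pN ?IHs // big_seq.
elim/big_ind: _ => [|a b ca cb|q qs]; rewrite ?coprimen1 ?coprimeMr ?ca //.
apply/coprimeXl/coprimeXr; have /andP[qp _] := sP' q qs.
rewrite prime_coprime // dvdn_prime2 //.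
by apply: contraNneq pNs => ->.
Qed.

Lemma prime_dvd_fact (p m : nat) : prime p -> p %| m`! -> p <= m.
Proof.
move=> pp; elim: m => [|m IHm]; first by rewrite fact0 dvdn1 => /eqP p1; rewrite p1 in pp.
rewrite factS Euclid_dvdM // => /orP[/dvdn_leq ->//|/IHm pm].
exact: leqW.
Qed.

(** The two equal middle coefficients of (1 + 1) ^ (2m + 1) sum to at most
    2 ^ (2m + 1). *)
Lemma central_bin_le (m : nat) : 'C(m.*2.+1, m) <= 4 ^ m.
Proof.
have mE : m.*2.+1 - m = m.+1 by lia.
suff : 2 * 'C(m.*2.+1, m) <= 2 ^ m.*2.+1.
  by rewrite expnS -muln2 mulnC -[4]/(2 ^ 2) -expnM [m * 2]mulnC mulnC leq_pmul2l.
rewrite [X in X ^ m.*2.+1](_ : 2 = 1 + 1) // expnDn.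
have lt1 : m < m.*2.+2 by lia.
have lt2 : m.+1 < m.*2.+2 by lia.
rewrite (bigD1 (Ordinal lt1)) //= (bigD1 (Ordinal lt2)) /=; last first.
  by apply/eqP => /(congr1 val) /=; lia.
rewrite !exp1n !muln1 addnA.
have -> : 'C(m.*2.+1, m.+1) = 'C(m.*2.+1, m).
  by rewrite -[RHS]bin_sub ?mE //; lia.
by rewrite mul2n -addnn leq_addr.
Qed.

(** Chebyshev's bound, by the Erdos argument: an even n > 2 adds no prime, and
    for n = 2m + 1 the primes in [m + 2, n] all divide 'C(n, m) <= 4 ^ m, which
    leaves the primorial of m + 1. *)
Lemma primorial_le (n : nat) : \prod_(0 <= p < n.+1 | prime p) p <= 4 ^ n.
Proof.
elim/ltn_ind: n => n IHn.
case: (leqP n 2) => [|n2].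
  by case: n IHn => [|[|[|]]] // _ _; rewrite unlock.
have [oddn|evenn] := boolP (odd n); last first.
  rewrite big_mkcond big_nat_recr //= -big_mkcond /=.
  have -> : prime n = false.
    by apply/negbTE; apply: contra evenn => /even_prime[n2E|//]; rewrite n2E in n2.
  have n0 : n = n.-1.+1 by lia.
  rewrite muln1 {1}n0 (leq_trans (IHn n.-1 _)) ?leq_exp2l //; lia.
set m := n./2; have nE : n = m.*2.+1 by lia.
have m0 : 0 < m by lia.
rewrite (@big_cat_nat _ _ _ m.+2) //=; last by lia.
have -> : 4 ^ n = 4 ^ m.+1 * 4 ^ m by rewrite -expnD; congr (_ ^ _); lia.
apply: leq_mul; first by apply: IHn; lia.
apply: leq_trans (central_bin_le m).
apply: dvdn_leq; first by rewrite bin_gt0; lia.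
rewrite -big_filter.
have -> : \prod_(p <- [seq p <- index_iota m.+2 n.+1 | prime p]) p
        = \prod_(p <- [seq p <- index_iota m.+2 n.+1 | prime p]) p ^ 1.
  by [].
apply: prod_prime_powers_dvd => [|p]; first by rewrite filter_uniq ?iota_uniq.
rewrite mem_filter mem_index_iota => /andP[pp /andP[mp pn]]; rewrite pp expn1 /=.
have : p %| n`! by apply: dvdn_fact; lia.
rewrite -(@bin_fact n m); last by lia.
rewrite !Euclid_dvdM // nE => /or3P[//|/prime_dvd_fact|/prime_dvd_fact] /(_ pp); lia.
Qed.

(** The multiples of p up to n alone contribute n %/ p to the exponent of p
    in n!. *)
Lemma prod_primes_dvd_fact (n : nat) :
  \prod_(0 <= p < n.+1 | prime p) p ^ (n %/ p) %| n`!.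
Proof.
rewrite -big_filter; apply: prod_prime_powers_dvd => [|p].
  by rewrite filter_uniq ?iota_uniq.
rewrite mem_filter mem_index_iota => /andP[pp /andP[_ pn]]; rewrite pp /=.
rewrite pfactor_dvdn ?fact_gt0 // logn_fact //.
have [->|n0] := posnP n; first by rewrite div0n.
by rewrite big_ltn // expn1 leq_addr.
Qed.

(** * Counting multiples and coprime integers over a period *)

Lemma sum_nat_blocks (q n : nat) (F : nat -> nat) :
  \sum_(0 <= x < n * q) F x = \sum_(0 <= w < n) \sum_(0 <= r < q) F (w * q + r).
Proof.
elim: n => [|n IHn]; first by rewrite !big_geq.
rewrite big_nat_recr //= -IHn mulSn addnC (@big_cat_nat _ _ _ (n * q)) ?leq_addr //=.
congr (_ + _); rewrite -{1}[n * q]add0n big_addn addKn.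
by apply: eq_bigr => r _; rewrite addnC.
Qed.

Lemma sum_multiples (q n : nat) (F : nat -> nat) : 0 < q ->
  \sum_(0 <= x < n * q | q %| x) F x = \sum_(0 <= w < n) F (w * q).
Proof.
move=> q0; rewrite big_mkcond sum_nat_blocks; apply: eq_bigr => w _.
rewrite big_ltn // addn0 dvdn_mull // big_nat big1 ?addn0 // => r /andP[r0 rq].
by rewrite dvdn_addr ?dvdn_mull // gtnNdvd.
Qed.

Lemma count_coprime (M n : nat) :
  \sum_(0 <= v < n * M) coprime M v = n * totient M.
Proof.
rewrite sum_nat_blocks totient_count_coprime.
rewrite (eq_bigr (fun=> \sum_(0 <= d < M) coprime M d)).
  by rewrite sum_nat_const_nat subn0.
by move=> w _; apply: eq_bigr => r _; rewrite /coprime gcdnMDl.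
Qed.

Lemma primes_fact (y : nat) : primes y`! = [seq p <- index_iota 0 y.+1 | prime p].
Proof.
apply: (irr_sorted_eq ltn_trans ltnn); rewrite ?sorted_primes //.
  by apply: sorted_filter (iota_ltn_sorted _ _); exact: ltn_trans.
move=> p; rewrite mem_primes fact_gt0 mem_filter mem_index_iota /= ltnS.
case: (boolP (prime p)) => //= pp; apply/idP/idP => [|py].
  exact: prime_dvd_fact.
by rewrite dvdn_fact // prime_gt0.
Qed.

Lemma coprime_fact_gt (y q : nat) : 0 < q -> q != 1 -> coprime q y`! -> y < q.
Proof.
move=> q0 q1 cq; rewrite ltnNge; apply/negP => qy.
have qf : q %| y`! by rewrite dvdn_fact // q0.
by move: cq; rewrite /coprime (gcdn_idPl qf) (negbTE q1).
Qed.

(** Let q = b / gcd a b; then b %| a v iff q %| v, and q > 1 because b does not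
    divide a. If q shares a prime with y! then no v counted here is coprime to
    y!; otherwise q > y, and divisibility by q and coprimality to y! are
    independent, so that at most a proportion 1 / y of the v coprime to y! are
    counted. *)
Lemma count_new_divisor (y a b N : nat) :
  0 < a -> 0 < b -> ~~ (b %| a) -> b * y`! %| N ->
  y * \sum_(0 <= v < N) ((b %| a * v) && coprime y`! v) <= N %/ y`! * totient y`!.
Proof.
move=> a0 b0 ba /dvdnP[n ->]; set M := y`!.
have M0 : 0 < M by rewrite fact_gt0.
have g0 : 0 < gcdn a b by rewrite gcdn_gt0 a0.
have [[q bE] [a' aE]] := (dvdnP (dvdn_gcdr a b), dvdnP (dvdn_gcdl a b)).
have cop : coprime q a'.
  by rewrite /coprime -(eqn_pmul2r g0) mul1n muln_gcdl -bE -aE gcdnC.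
move: (gcdn a b) g0 bE aE => g g0 bE aE.
have q0 : 0 < q by move: b0; rewrite bE muln_gt0 => /andP[].
have qv v : (b %| a * v) = (q %| v).
  by rewrite bE aE mulnAC dvdn_pmul2r // Gauss_dvdr.
rewrite mulnA mulnK //.
have q1 : q != 1.
  by apply: contraNneq ba => q1; rewrite bE aE q1 mul1n dvdn_mull.
have -> : n * b * M = n * g * M * q by rewrite bE; ring.
rewrite (eq_bigr (fun v => if q %| v then coprime M v : nat else 0)); last first.
  by move=> v _; rewrite qv; case: (q %| v).
rewrite -big_mkcond sum_multiples //.
have [cq|ncq] := boolP (coprime q M); last first.
  rewrite big1 ?muln0 // => w _; rewrite coprimeMr [coprime M q]coprime_sym.
  by rewrite (negbTE ncq) andbF.
have yq : y < q := coprime_fact_gt q0 q1 cq.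
rewrite (eq_bigr (fun w => coprime M w : nat)); last first.
  by move=> w _; rewrite coprimeMr [coprime M q]coprime_sym cq andbT.
rewrite count_coprime bE mulnA leq_mul2r orbC.
have -> : y * (n * g) = n * g * y by ring.
have -> : n * (q * g) = n * g * q by ring.
by rewrite leq_mul2l (ltnW yq) !orbT.
Qed.

Local Open Scope fset_scope.
Local Open Scope ring_scope.

(** * Upper bounds of Mertens type *)

Section Mertens.
Variable R : realType.
Implicit Types n p : nat.

Lemma ln_natr_ge0 n : 0 <= ln (n%:R : R).
Proof.
case: n => [|n]; first by rewrite ln0.
by rewrite ln_ge0 // ler1n.
Qed.

Lemma ler_ln_natr m n : (0 < m)%N -> (m <= n)%N -> ln (m%:R : R) <= ln n%:R.
Proof. by move=> m0 mn; rewrite ler_ln ?posrE ?ltr0n ?ler_nat //; lia. Qed.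

Lemma ln_prod_natr (s : seq nat) (P : pred nat) (F : nat -> nat) :
  (forall i, P i -> (0 < F i)%N) ->
  ln ((\prod_(i <- s | P i) F i)%N%:R : R) = \sum_(i <- s | P i) ln (F i)%:R.
Proof.
move=> F0; have : (0 < \prod_(i <- s | P i) F i)%N &&
  (ln ((\prod_(i <- s | P i) F i)%N%:R : R) == \sum_(i <- s | P i) ln (F i)%:R).
  elim/big_rec2: _ => [|i y x Pi /andP[x0 /eqP <-]]; first by rewrite ln1 eqxx.
  by rewrite muln_gt0 F0 // x0 natrM lnM ?posrE ?ltr0n ?F0 //=.
by move=> /andP[_ /eqP].
Qed.

Lemma ln_fact_le n : ln (n`!%:R : R) <= n%:R * ln n%:R.
Proof.
have [->|n0] := posnP n; first by rewrite fact0 ln1 mul0r.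
rewrite mulr_natl -lnXn ?ltr0n // -natrX ler_ln_natr ?fact_gt0 //.
rewrite fact_prod (@leq_trans (\prod_(1 <= i < n.+1) n)%N) //.
  rewrite big_seq [leqRHS]big_seq; apply: leq_prod => i.
  by rewrite mem_index_iota; lia.
by rewrite prod_nat_const_nat subn1.
Qed.

Lemma sum_ln_prime_le n :
  \sum_(0 <= p < n.+1 | prime p) ln (p%:R : R) <= n%:R * ln 4.
Proof.
rewrite -ln_prod_natr => [|p /prime_gt0 //].
rewrite mulr_natl -lnXn // -natrX ler_ln_natr ?primorial_le //.
by rewrite prodn_cond_gt0 // => p /prime_gt0.
Qed.

Definition sum_ln_div_prime n : R := \sum_(0 <= p < n.+1 | prime p) ln p%:R / p%:R.

(** Upper half of Mertens' first theorem: take logarithms of the divisor of n!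
    given by [prod_primes_dvd_fact]. Replacing n %/ p by n / p costs one ln p
    for each prime p <= n, n ln 4 in total by Chebyshev. *)
Lemma mertens1 n : (0 < n)%N -> sum_ln_div_prime n <= ln n%:R + ln 4.
Proof.
move=> n0; have n0R : 0 < n%:R :> R by rewrite ltr0n.
rewrite -(ler_pM2l n0R) mulrDr mulr_sumr.
apply: (@le_trans _ _ (\sum_(0 <= p < n.+1 | prime p)
    (ln (p ^ (n %/ p))%N%:R + ln (p%:R : R)))).
  apply: ler_sum => p /prime_gt0 p0.
  rewrite natrX lnXn ?ltr0n // -mulrSr -[leRHS]mulr_natl mulrA mulrAC.
  apply: ler_wpM2r; first exact: ln_natr_ge0.
  rewrite ler_pdivrMr ?ltr0n // -natrM ler_nat.
  exact/ltnW/ltn_ceil.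
rewrite big_split /= lerD ?sum_ln_prime_le //.
apply: le_trans (ln_fact_le n).
rewrite -ln_prod_natr => [|p /prime_gt0 p0]; last by rewrite expn_gt0 p0.
have D := prod_primes_dvd_fact n.
rewrite ler_ln_natr ?(dvdn_leq _ D) ?fact_gt0 //.
by rewrite prodn_cond_gt0 // => p /prime_gt0 p0; rewrite expn_gt0 p0.
Qed.

Definition prime_recip_sum n : R := \sum_(0 <= p < n.+1 | prime p) (p%:R)^-1.

Lemma ln_ge_1BV (x : R) : 0 < x -> 1 - x^-1 <= ln x.
Proof.
move=> x0; have := expR_ge1Dx (- ln x).
by rewrite expRN lnK ?posrE //; lra.
Qed.

(** Discrete Abel summation as a monotone quantity. With S the sum of ln p / p,
    the difference (sum of 1/p) - S n / ln n grows from n to n + 1 by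
    S n * (1 / ln n - 1 / ln (n + 1)), whether or not n + 1 is prime. By
    [mertens1] this is at most (1 - ln n / ln (n + 1)), itself at most the
    increment of ln ln, plus ln 4 times the decrement of 1 / ln. *)
Lemma mertens2_potential_step n : (1 < n)%N ->
  prime_recip_sum n.+1 - sum_ln_div_prime n.+1 / ln n.+1%:R
    - ln (ln n.+1%:R) + ln 4 / ln n.+1%:R <=
  prime_recip_sum n - sum_ln_div_prime n / ln n%:R - ln (ln n%:R) + ln 4 / ln n%:R.
Proof.
move=> n1; have := @mertens1 n (ltnW n1).
have a0 : 0 < ln (n%:R : R) by rewrite ln_gt0 // ltr1n.
have ab : ln (n%:R : R) < ln n.+1%:R by rewrite ltr_ln ?posrE ?ltr_nat ?ltr0n //; lia.
have -> : prime_recip_sum n.+1 =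
    prime_recip_sum n + (if prime n.+1 then n.+1%:R^-1 else 0).
  by rewrite /prime_recip_sum big_mkcond big_nat_recr //= -big_mkcond.
have -> : sum_ln_div_prime n.+1 =
    sum_ln_div_prime n + (if prime n.+1 then ln n.+1%:R / n.+1%:R else 0).
  by rewrite /sum_ln_div_prime big_mkcond big_nat_recr //= -big_mkcond.
move: ab a0; set b := ln n.+1%:R; set a := ln n%:R => ab a0.
have b0 : 0 < b by apply: lt_trans ab.
move: (sum_ln_div_prime n) (prime_recip_sum n) (ln 4) => S T C SC.
have Lab : ln b - ln a >= 1 - a / b.
  rewrite -ln_div ?posrE //; apply: le_trans (ln_ge_1BV _); last exact: divr_gt0.
  by rewrite invf_div.
have key : (S - C) * (a^-1 - b^-1) <= 1 - a / b.
  have -> : 1 - a / b = a * (a^-1 - b^-1) by field; rewrite ?gt_eqF.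
  apply: ler_wpM2r; last lra.
  by rewrite subr_ge0 lef_pV2 ?posrE // ltW.
have -> : (S + (if prime n.+1 then b / n.+1%:R else 0)) / b =
   S / b + (if prime n.+1 then n.+1%:R^-1 else 0).
  rewrite mulrDl; congr (_ + _); case: ifP => _; last by rewrite mul0r.
  have : 0 < n.+1%:R :> R by rewrite ltr0n.
  by move: (n.+1%:R) => m m0; field; rewrite !gt_eqF.
move: key; rewrite mulrBl !mulrBr; lra.
Qed.

(** Upper half of Mertens' second theorem: the quantity of
    [mertens2_potential_step] never exceeds its value at 2, and S n / ln n is
    bounded by [mertens1]. The leading constant 1 in front of ln ln n is what
    makes the final bound lose a single logarithm. *)
Lemma mertens2 : exists K : R, forall n, (1 < n)%N ->
  prime_recip_sum n <= ln (ln n%:R) + K.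
Proof.
pose U n := prime_recip_sum n - sum_ln_div_prime n / ln n%:R - ln (ln n%:R) + ln 4 / ln n%:R.
exists (U 2 + 1) => n n1.
have a0 : 0 < ln (n%:R : R) by rewrite ln_gt0 // ltr1n.
have Un : U n <= U 2.
  elim: n n1 {a0} => // n IHn; rewrite ltnS leq_eqVlt => /orP[/eqP<- //|n1].
  exact: le_trans (mertens2_potential_step n1) (IHn n1).
have : sum_ln_div_prime n / ln n%:R <= 1 + ln 4 / ln n%:R.
  rewrite ler_pdivrMr // mulrDl mul1r divfK ?gt_eqF //.
  by apply: mertens1; lia.
move: Un; rewrite {1}/U; lra.
Qed.

(** The terms are among those of the telescoping series 1 / (i - 1) - 1 / i
    over i > 1. *)
Lemma sum_invM_le n (P : pred nat) : (forall i, P i -> (1 < i)%N) ->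
  \sum_(0 <= p < n.+1 | P p) ((p%:R)^-1 / (p.-1)%:R : R) <= 1.
Proof.
move=> P1; apply: (@le_trans _ _ (1 - n%:R^-1)); last first.
  by rewrite lerBlDr lerDl invr_ge0.
elim: n => [|n IHn].
  rewrite big_mkcond big_nat1; case: ifP => [/P1 //|_].
  by rewrite invr0 subr0.
rewrite big_mkcond big_nat_recr //= -big_mkcond /=.
case: n IHn => [|n] IHn.
  rewrite big_mkcond big_nat1.
  by case: ifP => [/P1 //|_]; case: ifP => [/P1 //|_]; rewrite invr1 subrr addr0.
have E : n.+2%:R^-1 / n.+1%:R = n.+1%:R^-1 - n.+2%:R^-1 :> R.
  rewrite -(natr1 n.+1); have : 0 < n.+1%:R :> R by rewrite ltr0n.
  by move: (n.+1%:R) => m m0; field; rewrite !gt_eqF //; lra.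
have : 0 <= n.+2%:R^-1 / n.+1%:R :> R by rewrite divr_ge0 ?invr_ge0.
rewrite E; move: IHn; case: ifP => _ /=; rewrite ?E;
  by move: (n.+1%:R^-1) (n.+2%:R^-1) (\sum_(0 <= i < _ | P i) _) => u v S; lra.
Qed.

(** Since 1 / (1 - 1/p) = 1 + 1/(p - 1) <= exp (1/(p - 1)) and
    1/(p - 1) = 1/p + 1/(p (p - 1)), Mertens' second theorem bounds the product
    up to the convergent sum of [sum_invM_le]. *)
Lemma prod_prime_ge : exists c : R, 0 < c /\ forall n, (1 < n)%N ->
  c / ln n%:R <= \prod_(0 <= p < n.+1 | prime p) (1 - (p%:R)^-1).
Proof.
have [K KP] := mertens2; exists (expR (- (K + 1))); split; first exact: expR_gt0.
move=> n n1; have a0 : 0 < ln (n%:R : R) by rewrite ln_gt0 // ltr1n.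
rewrite -[X in _ / X]lnK ?posrE // -expRN -expRD.
apply: (@le_trans _ _ (expR (\sum_(0 <= p < n.+1 | prime p)
     (- (p%:R^-1 + p%:R^-1 / (p.-1)%:R))))).
  rewrite ler_expR sumrN big_split /=.
  have := @sum_invM_le n prime (fun p pp => prime_gt1 pp).
  have := KP n n1; rewrite /prime_recip_sum.
  lra.
rewrite expR_sum; apply: ler_prod => p /prime_gt1 p1; rewrite expR_ge0 /=.
have q0 : 0 < p.-1%:R :> R by rewrite ltr0n; lia.
have pE : p%:R = p.-1%:R + 1 :> R by rewrite natr1; congr (_%:R); lia.
have -> : p%:R^-1 + p%:R^-1 / p.-1%:R = p.-1%:R^-1 :> R.
  by rewrite pE; field; rewrite !gt_eqF //; lra.
have -> : 1 - p%:R^-1 = (1 + p.-1%:R^-1)^-1 :> R.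
  by rewrite pE; field; rewrite !gt_eqF //; lra.
rewrite expRN lef_pV2 ?posrE ?expR_gt0 ?expR_ge1Dx //.
Qed.
End Mertens.

(** * The density as an average of alternating sums *)

Lemma fset_min_mem (S : {fset nat}) : S != fset0 -> fset_min S \in S.
Proof.
move=> /fset0Pn[a aS]; rewrite /fset_min -(mem_sort leq).
have : a \in sort leq S by rewrite mem_sort.
by case: (sort leq S) => //= b s _; rewrite mem_head.
Qed.

Lemma fset_min_le (S : {fset nat}) a : a \in S -> (fset_min S <= a)%N.
Proof.
rewrite /fset_min -(mem_sort leq); have := sort_sorted leq_total S.
case: (sort leq S) => //= b s; rewrite (path_sortedE leq_trans) => /andP[/allP bs _].
by rewrite inE => /predU1P[->//|/bs].
Qed.

Lemma fset_minU1 (S : {fset nat}) a : S != fset0 ->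
  (forall b, b \in S -> (b < a)%N) -> fset_min (a |` S) = fset_min S.
Proof.
move=> S0 Sa; have mS := fset_min_mem S0.
apply/eqP; rewrite eqn_leq; apply/andP; split.
  by apply: fset_min_le; rewrite in_fsetU mS orbT.
have : fset_min (a |` S) \in a |` S.
  by apply: fset_min_mem; apply/fset0Pn; exists a; rewrite fset1U1.
rewrite in_fsetU in_fset1 => /predU1P[->|]; last exact: fset_min_le.
exact/ltnW/Sa.
Qed.

Lemma big_fpowersetU1 (R : nmodType) (a : nat) (D : {fset nat})
    (F : {fset nat} -> R) : a \notin D ->
  \sum_(S <- fpowerset (a |` D)) F S =
  \sum_(S <- fpowerset D) F S + \sum_(S <- fpowerset D) F (a |` S).
Proof.
move=> aD; rewrite (big_fsetID _ (fun S : {fset nat} => a \notin S)) /=.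
congr (_ + _).
  apply: eq_fbigl => S; rewrite !inE !fpowersetE.
  apply/andP/idP => [[/fsubsetP SD aS]|SD]; last first.
    rewrite (fsubset_trans SD) ?fsubsetU1 //; split=> //.
    by apply: contra aD; apply: fsubsetP.
  apply/fsubsetP => b bS; have := SD b bS; rewrite !inE => /predU1P[ba|//].
  by move: aS; rewrite -ba bS.
have -> : \sum_(S <- fpowerset D) F (a |` S) =
    \sum_(S <- [fset a |` T | T in fpowerset D]) F S.
  rewrite [RHS]big_imfset //=.
  move=> S T; rewrite !fpowersetE => SD TD E.
  have aS : a \notin S by apply: contra aD; apply: fsubsetP.
  have aT : a \notin T by apply: contra aD; apply: fsubsetP.
  by rewrite -[S](fsetU1K aS) E fsetU1K.
apply: eq_fbigl => S; rewrite !inE fpowersetE negbK; apply/andP/imfsetP => /=.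
  move=> [SD aS]; exists (S `\ a); last by rewrite fsetD1K.
  by rewrite fpowersetE fsubDset.
move=> [T]; rewrite fpowersetE => TD ->; split; last by rewrite fset1U1.
exact: fsetUS.
Qed.

Section AltSum.
Variable R : realType.
Implicit Types (A D S : {fset nat}) (a x y : nat).

Definition signed_min S : R := (- 2%:R) ^+ (#|` S|).-1 * (fset_min S)%:R.

(** On D = {d_1 < ... < d_m} this equals d_m - d_(m-1) + d_(m-2) - ..., that
    is, the measure of the t > 0 for which an odd number of elements of D are at
    least t. *)
Definition altsum D : R := \sum_(S <- fpowerset D | S != fset0) signed_min S.

Lemma altsumE D :
  altsum D = \sum_(S <- fpowerset D `\ fset0) signed_min S.
Proof.
have E0 : fset0 \in fpowerset D by rewrite fpowersetE fsub0set.
rewrite /altsum big_mkcond /= (big_fsetD1 _ E0) /= add0r.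
rewrite big_seq [RHS]big_seq; apply: eq_bigr => S.
by rewrite in_fsetD1 => /andP[->].
Qed.

Lemma altsum0 : altsum fset0 = 0.
Proof. by rewrite /altsum fpowerset0 big_mkcond big_seq_fset1 eqxx. Qed.

(** Adding a new maximum a: the subset {a} contributes a, and adding a to a
    nonempty subset keeps its minimum while multiplying its sign factor by -2, so
    these subsets contribute -2 (altsum D). *)
Lemma altsumU1 D a : (forall b, b \in D -> (b < a)%N) ->
  altsum (a |` D) = a%:R - altsum D.
Proof.
move=> Da; have aD : a \notin D by apply/negP => /Da; rewrite ltnn.
have aS0 S : (a |` S != fset0) by apply/fset0Pn; exists a; rewrite fset1U1.
rewrite {1}/altsum big_mkcond /= big_fpowersetU1 // -big_mkcond /= -/(altsum D).
under [X in _ + X = _]eq_bigr => S _ do rewrite aS0.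
have E0 : fset0 \in fpowerset D by rewrite fpowersetE fsub0set.
rewrite (big_fsetD1 _ E0) /=.
have -> : signed_min (a |` fset0) = a%:R.
  rewrite /signed_min fsetU0 cardfs1 expr0 mul1r; congr (_%:R).
  have : fset_min [fset a] \in [fset a].
    by apply: fset_min_mem; apply/fset0Pn; exists a; rewrite in_fset1.
  by rewrite in_fset1 => /eqP.
have -> : \sum_(S <- fpowerset D `\ fset0) signed_min (a |` S) = - 2 * altsum D.
  rewrite altsumE mulr_sumr big_seq [RHS]big_seq.
  apply: eq_bigr => S; rewrite in_fsetD1 fpowersetE => /andP[S0 SD].
  have Sa b : b \in S -> (b < a)%N by move=> bS; apply: Da; apply: (fsubsetP SD).
  have aS : a \notin S by apply/negP => /Sa; rewrite ltnn.
  rewrite /signed_min fset_minU1 // cardfsU1 aS /= mulrA -exprS prednK //.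
  by rewrite cardfs_gt0.
ring.
Qed.

(** By strong induction on the cardinal: for a the maximum, altsum D is a minus a
    value that lies between 0 and a. *)
Lemma altsum_bounds D y : (forall b, b \in D -> (b <= y)%N) ->
  0 <= altsum D <= y%:R.
Proof.
have [n] := ubnP #|` D|; elim: n D y => // n IHn D y; rewrite ltnS => Dn Dy.
have [->|/fset0Pn[d0 d0D]] := eqVneq D fset0; first by rewrite altsum0 lexx ler0n.
have [a aD amax] : {a | a \in D & forall b, b \in D -> (b <= a)%N}.
  by case: (@ex_maxnP (fun x => x \in D) y) => [|//|a aD am]; [exists d0|exists a].
have ltDa b : b \in D `\ a -> (b < a)%N.
  by rewrite in_fsetD1 => /andP[ba /amax]; rewrite leq_eqVlt (negbTE ba).
have : 0 <= altsum (D `\ a) <= a%:R.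
  apply: IHn => [|b /ltDa /ltnW //].
  by move: Dn; rewrite (cardfsD1 a) aD.
have ay : a%:R <= y%:R :> R by rewrite ler_nat Dy.
rewrite -{3 4}(fsetD1K aD) altsumU1 // => /andP[h1 h2]; apply/andP; split; lra.
Qed.

(** Removing the maximum a leaves proper divisors of a, all at most a / 2. *)
Lemma altsum_ge_half D a : a \in D -> (0 < a)%N ->
  (forall b, b \in D -> b %| a)%N -> a%:R / 2 <= altsum D.
Proof.
move=> aD a0 Da.
have lt2 b : b \in D `\ a -> (b.*2 <= a)%N.
  rewrite in_fsetD1 => /andP[/eqP ba /Da /dvdnP[[|[|m]] aE]]; [lia|lia|nia].
have ltDa b : b \in D `\ a -> (b < a)%N by move=> /lt2; lia.
rewrite -(fsetD1K aD) altsumU1 //.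
have /andP[_] : 0 <= altsum (D `\ a) <= (a./2)%:R.
  by apply: altsum_bounds => b /lt2 ba; lia.
have : (a./2)%:R + (a./2)%:R <= a%:R :> R by rewrite -natrD ler_nat; lia.
lra.
Qed.

Lemma fset_lcm_dvd S x : (fset_lcm S %| x)%N = all (dvdn^~ x) S.
Proof.
rewrite /fset_lcm; elim: (S : seq nat) => [|a s IHs]; first by rewrite big_nil dvd1n.
by rewrite big_cons dvdn_lcm IHs.
Qed.

Lemma hsetE A : hset A =
  \sum_(S <- fpowerset A | S != fset0) signed_min S / (fset_lcm S)%:R :> R.
Proof.
rewrite /hset; under eq_bigr => r _ do rewrite big_mkcond.
rewrite exchange_big /= [RHS]big_mkcond big_seq [RHS]big_seq.
apply: eq_bigr => S; rewrite fpowersetE => SA.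
rewrite -big_mkcond; under eq_bigl => r do rewrite eq_sym.
rewrite big_nat1_eq cardfs_gt0 ltnS fsubset_leq_card // andbT.
by rewrite /signed_min mulrA.
Qed.

Lemma count_multiples (d L : nat) : (0 < L)%N -> (d %| L)%N ->
  (\sum_(0 <= x < L) (d %| x)%N)%:R = L%:R / d%:R :> R.
Proof.
move=> + /dvdnP[n LE]; rewrite LE muln_gt0 => /andP[_ d0].
rewrite -(big_mkcond (dvdn d) (fun=> 1%N)) sum_multiples // sum_nat_const_nat.
by rewrite subn0 muln1 natrM mulfK // pnatr_eq0 -lt0n.
Qed.

(** For S a set of divisors of L, the quotient L / lcm S counts the x < L
    divisible by all of S. Exchanging the sums groups, for each x, the subsets of
    the elements of A that divide x. *)
Lemma hset_average A (L : nat) : (0 < L)%N -> (forall a, a \in A -> a %| L)%N ->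
  L%:R * hset A = \sum_(0 <= x < L) altsum [fset a in A | (a %| x)%N] :> R.
Proof.
move=> L0 AL.
have altE x : altsum [fset a in A | (a %| x)%N] =
    \sum_(S <- fpowerset A | S != fset0) signed_min S * (fset_lcm S %| x)%N%:R.
  rewrite (bigID (fun S => fset_lcm S %| x)%N) /= [X in _ + X]big1 ?addr0; last first.
    by move=> S /andP[_ /negPf ->]; rewrite mulr0.
  apply/esym/eq_fbig_cond => [S|S _ /andP[_ ->]]; last by rewrite mulr1.
  apply/esym; rewrite !inE !fpowersetE fset_lcm_dvd.
  case: (S != fset0); rewrite ?andbT ?andbF //.
  apply/fsubsetP/andP => [SD|[/fsubsetP SA /allP Sx] a aS].
    split; first by apply/fsubsetP => a /SD; rewrite !inE => /andP[].
    by apply/allP => a /SD; rewrite !inE => /andP[].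
  by rewrite !inE SA //= Sx.
under eq_bigr => x _ do rewrite altE.
rewrite exchange_big /= hsetE mulr_sumr big_seq_cond [RHS]big_seq_cond.
apply: eq_bigr => S /andP[]; rewrite fpowersetE => /fsubsetP SA _.
rewrite -mulr_sumr -natr_sum count_multiples //; first by rewrite mulrCA.
by rewrite fset_lcm_dvd; apply/allP => a /SA /AL.
Qed.

End AltSum.

(** * Top divisors and the lower bound *)

(** For fixed x at most one a of A qualifies, two such elements dividing each
    other. *)
Definition top_divisor (A : {fset nat}) (a x : nat) : bool :=
  (a %| x)%N && all (fun b => (b %| x)%N ==> (b %| a)%N) A.

(** Write x = a w. If w is coprime to y! and a is not the top divisor of x,
    some b of A that does not divide a divides a w; by [count_new_divisor] each b
    accounts for at most a proportion 1 / y of the w coprime to y!. The factor y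
    and the term moved to the left avoid divisions and subtractions in nat. *)
Lemma count_top_divisor (A : {fset nat}) (y a N : nat) :
  positive_fset A -> a \in A ->
  (forall b, b \in A -> b * y`! %| N)%N ->
  (y * (N %/ y`! * totient y`!) <=
   y * (\sum_(0 <= x < N * a) top_divisor A a x)
   + #|` A| * (N %/ y`! * totient y`!))%N.
Proof.
move=> A0 aA AN; have a0 := A0 a aA.
set T := (N %/ y`! * totient y`!)%N.
have TE : T = (\sum_(0 <= v < N) coprime y`! v)%N.
  by rewrite /T -count_coprime divnK // (dvdn_trans _ (AN a aA)) // dvdn_mull.
have -> : (\sum_(0 <= x < N * a) top_divisor A a x)%N =
   (\sum_(0 <= w < N) all (fun b => (b %| a * w)%N ==> (b %| a)%N) A)%N.
  rewrite (eq_bigr (fun x => if (a %| x)%N then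
      nat_of_bool (all (fun b => (b %| x)%N ==> (b %| a)%N) A) else 0%N)); last first.
    by move=> x _; rewrite /top_divisor; case: (a %| x)%N.
  rewrite -big_mkcond sum_multiples //.
  by apply: eq_bigr => w _; rewrite mulnC.
have bad : (\sum_(b <- A | ~~ (b %| a)%N)
    y * \sum_(0 <= v < N) ((b %| a * v)%N && coprime y`! v) <= #|` A| * T)%N.
  rewrite -sum1_size big_distrl /= [leqRHS](bigID (fun b => b %| a)%N) /=.
  apply: leq_trans (leq_addl _ _).
  rewrite big_seq_cond [leqRHS]big_seq_cond; apply: leq_sum => b /andP[bA ba].
  rewrite mul1n; apply: count_new_divisor => //; [exact: A0|exact: AN].
apply: leq_trans (leq_add (leqnn _) bad).
rewrite -big_distrr -mulnDr leq_mul2l TE; apply/orP; right.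
rewrite [X in (_ + X)%N]exchange_big -big_split; apply: leq_sum => w _ /=.
case cw : (coprime y`! w) => //.
have [//|/allPn[b bA]] := boolP (all _ A).
rewrite negb_imply => /andP[bw ba].
by rewrite add0n big_mkcond (big_fsetD1 _ bA) /= ba bw.
Qed.

Section LowerBound.
Variable R : realType.

Lemma altsum_divisors_ge (A : {fset nat}) (x : nat) : positive_fset A ->
  \sum_(a <- A) (a%:R / 2 * (top_divisor A a x)%:R) <=
  altsum R [fset a in A | (a %| x)%N].
Proof.
move=> A0.
have [/hasP[a aA axA]|/hasPn no] := boolP (has (fun a => top_divisor A a x) A).
  have /andP[ax /allP Ax] := axA.
  rewrite (big_fsetD1 _ aA) /= axA mulr1 big1_fset ?addr0.
    apply: altsum_ge_half; rewrite ?inE ?aA ?A0 //= => b; rewrite !inE.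
    by move=> /andP[bA bx]; have := Ax b bA; rewrite bx.
  move=> b; rewrite in_fsetD1 => /andP[ba bA] _.
  suff -> : top_divisor A b x = false by rewrite mulr0.
  apply/negP => /andP[bx /allP Bx]; move/negP: ba; apply.
  by rewrite eqn_dvd; have := Ax b bA; have := Bx a aA; rewrite ax bx => /= -> ->.
rewrite big_seq big1 => [|a aA]; last by rewrite (negbTE (no a aA)) mulr0.
pose y := \max_(a <- A) a.
suff : 0 <= altsum R [fset a | a in A & (a %| x)%N] <= y%:R by case/andP.
apply: altsum_bounds => b; rewrite !inE => /andP[bA _].
by rewrite /y (big_fsetD1 _ bA) /= leq_maxl.
Qed.

Lemma totient_fact_ratio (y : nat) :
  (totient y`!)%:R / (y`!)%:R =
  \prod_(0 <= p < y.+1 | prime p) (1 - (p%:R)^-1) :> R.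
Proof.
have ME : (y`! = \prod_(p <- primes y`!) p ^ logn p y`!)%N.
  by rewrite {1}[y`!]prod_prime_decomp ?fact_gt0 // prime_decompE big_map.
rewrite totientE ?fact_gt0 // [X in _ / X%:R]ME !natr_prod -prodf_div.
rewrite -[RHS]big_filter -primes_fact big_seq [RHS]big_seq; apply: eq_bigr => p.
move=> pM; have p0 : (0 < p)%N by move: pM; rewrite mem_primes => /andP[/prime_gt0].
move: pM; rewrite -logn_gt0; case: (logn p y`!) => // e _.
have p0R : 0 < p%:R :> R by rewrite ltr0n.
have e0R : 0 < (p ^ e)%N%:R :> R by rewrite ltr0n expn_gt0 p0.
rewrite expnS !natrM -subn1 natrB //=.
by move: (p%:R) ((p ^ e)%N%:R) p0R e0R => P Q P0 Q0; field; rewrite !gt_eqF.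
Qed.

(** Each a of A is the top divisor of at least a proportion
    (1 / a) (1 - |A| / y) (totient M / M) of all x, where M = y!, and then
    contributes at least a / 2 to the average: the factors a cancel. *)
Lemma hset_ge (A : {fset nat}) (y : nat) : positive_fset A -> (0 < y)%N ->
  #|` A|%:R / 2 * (1 - #|` A|%:R / y%:R) * ((totient y`!)%:R / (y`!)%:R) <=
  hset A :> R.
Proof.
move=> A0 y0; set M := y`!; set k := #|` A|.
have M0 : (0 < M)%N := fact_gt0 y.
pose P := (\prod_(a <- A) a)%N.
have P0 : (0 < P)%N.
  rewrite /P big_seq; apply: prodn_cond_gt0 => a aA; exact: A0.
have AP a : a \in A -> (a %| P)%N.
  by move=> aA; rewrite /P (big_fsetD1 _ aA) dvdn_mulr.
(* For a, b in A the period L is a multiple of a * (b * M), which is what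
   counting the w < L / a in [count_top_divisor] asks for. *)
pose L := (M * P * P)%N.
have L0 : (0 < L)%N by rewrite !muln_gt0 M0 P0.
have L0R : 0 < L%:R :> R by rewrite ltr0n.
have AL a : a \in A -> (a %| L)%N by move=> aA; rewrite dvdn_mull ?AP.
rewrite -(ler_pM2l L0R) hset_average //.
apply: (@le_trans _ _ (\sum_(0 <= x < L)
    \sum_(a <- A) a%:R / 2 * (top_divisor A a x)%:R));
  last by apply: ler_sum => x _; exact: altsum_divisors_ge.
rewrite exchange_big /=.
pose t : R := L%:R / 2 * (1 - k%:R / y%:R) * ((totient M)%:R / M%:R).
apply: (@le_trans _ _ (\sum_(a <- A) t)).
  by rewrite big_const_seq count_predT iter_addr_0 -mulr_natl -/k /t; lra.
rewrite big_seq [leRHS]big_seq; apply: ler_sum => a aA.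
rewrite -mulr_sumr -natr_sum.
have a0 := A0 a aA.
have LE : L = (M * P * (P %/ a) * a)%N by rewrite /L -[RHS]mulnA divnK // AP.
have bN b : b \in A -> (b * M %| M * P * (P %/ a))%N.
  by move=> bA; rewrite dvdn_mulr // mulnC dvdn_pmul2l // AP.
have := count_top_divisor A0 aA bN; rewrite -LE -/M -/k.
set C := (\sum_(0 <= x < L) _)%N.
have -> : (M * P * (P %/ a) %/ M = P * (P %/ a))%N by rewrite -mulnA mulKn.
rewrite -(ler_nat R) natrD !natrM => ineq.
have y0R : 0 < y%:R :> R by rewrite ltr0n.
have a0R : 0 < a%:R :> R by rewrite ltr0n.
have M0R : 0 < M%:R :> R by rewrite ltr0n.
rewrite /t LE !natrM; move: ineq.
move: (P%:R : R) ((P %/ a)%:R : R) ((totient M)%:R : R) (C%:R : R) => p q f c.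
move: y0R a0R M0R (k%:R : R); move: (y%:R : R) (a%:R : R) (M%:R : R).
move=> Y B N Y0 B0 N0 K ineq.
have -> : N * p * q * B / 2 * (1 - K / Y) * (f / N) =
    B / 2 * ((Y * (p * q * f) - K * (p * q * f)) / Y).
  by field; rewrite !gt_eqF.
apply: ler_wpM2l; first by rewrite divr_ge0 // ltW.
by rewrite ler_pdivrMr // lerBlDr mulrC [c * _]mulrC mulrC.
Qed.

End LowerBound.

Theorem corollary1p7 (R : realType) :
  exists c : R, 0 < c /\
    forall k : nat, (0 < k)%N -> k <> 1%N ->
      c * (k%:R / ln k%:R) <= hcard k.
Proof.
have [c [c0 cP]] := prod_prime_ge R.
exists (c / 8); split; first by rewrite divr_gt0.
move=> k k0 k1; have k2 : (1 < k)%N by lia.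
apply: lb_le_inf.
  pose I := [fset (i : nat) | i in iota 1 k]; exists (hset I), I => //=.
  split; first by move=> a; rewrite !inE /= mem_iota => /andP[].
  by rewrite card_imfset //= undup_id ?iota_uniq // size_iota.
move=> _ [A [A0 Ak] <-].
(* With y = 2k the factor 1 - k / y is 1/2, and ln y <= 2 ln k. *)
have y0 : (0 < k.*2)%N by rewrite double_gt0.
apply: le_trans (hset_ge R A0 y0); rewrite Ak totient_fact_ratio.
have k0R : 0 < k%:R :> R by rewrite ltr0n.
have -> : 1 - k%:R / (k.*2)%:R = 2^-1 :> R.
  by rewrite -muln2 natrM; field; rewrite gt_eqF.
have l0 : 0 < ln (k%:R : R) by rewrite ln_gt0 // ltr1n.
have l2 : ln (k.*2%:R : R) <= 2 * ln k%:R.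
  rewrite -muln2 natrM lnM ?posrE // mulr2n mulrDl mul1r lerD2l.
  by rewrite (ler_ln_natr R (m := 2)).
have l20 : 0 < ln (k.*2%:R : R) by rewrite ln_gt0 // ltr1n; lia.
have -> : c / 8 * (k%:R / ln k%:R) = k%:R / 2 * 2^-1 * (c / (2 * ln k%:R)).
  by field; rewrite gt_eqF.
apply: ler_wpM2l; first by rewrite !mulr_ge0 // ltW.
apply: le_trans (cP k.*2 _); last by lia.
by rewrite ler_pM2l // lef_pV2 ?posrE // mulr_gt0.
Qed.
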